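(* Let $M^3_{\mathrm{sing}}\subset\mathbb{R}^5$ be the singular corank 1 $3$-manifold obtained from a regular $3$-manifold $M^3_{\mathrm{reg}}\subset\mathbb{R}^6$ by orthogonal projection along a tangent direction at $p$. Suppose the direction of projection is an asymptotic direction. Then the curvature locus of the singular manifold has at least one singularity less than the curvature locus of the regular manifold. In particular, if the direction of projection corresponds to a cross-cap singularity, this cross-cap goes to infinity in the locus of the singular manifold.
   Context: Setting. $M^3_{\mathrm{reg}}$ is given near the origin $p$ in Monge form $(x,y,z)\mapsto(x,y,z,f_1,f_2,f_3)$, the $f_i$ having zero constant and linear parts. After a rotation of the tangent space the direction of projection is taken to be $(0,0,1)$, so $M^3_{\mathrm{sing}}$ is parametrised by $(x,y,z)\mapsto(x,y,f_1,f_2,f_3)$. Both manifolds have the same second fundamental form $II$ at the origin. Asymptotic directions. A unit tangent direction $u$ is asymptotic if there is a unit normal vector $\nu$ such that $II_\nu(u,w)=\langle\nu,II(u,w)\rangle=0$ for every tangent direction $w$. Curvature loci. The curvature locus of $M^3_{\mathrm{reg}}$ is the image of $\eta(u)=II(u,u)$ on the unit sphere $\mathbb{S}^2=\{x^2+y^2+z^2=1\}$. The curvature locus of $M^3_{\mathrm{sing}}$ is the image of $\eta(u)=II(u,u)$ on the cylinder $C_q=\{x^2+y^2=1\}$ of unit vectors for the (degenerate) first fundamental form. The singularities of each locus are those of $\eta$ (antipodal points have the same image and are counted once). A cross-cap is a singularity equivalent, up to smooth changes of coordinates in source and target, to $(x,y)\mapsto(x,y^2,xy)$. The direction of projection corresponds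 to a given singularity of the regular locus if that singularity is the germ of $\eta$ at this direction. Matrices. $M_f^{\mathrm{reg}}$ (resp. $M_f^{\mathrm{sing}}$) is the $4\times3$ matrix whose first three rows are the gradients of the 2-jets $j^2f_1,j^2f_2,j^2f_3$ at the origin with respect to $(x,y,z)$, and whose fourth row is the gradient of $x^2+y^2+z^2-1$ (resp. of $x^2+y^2-1$). $V(M)$ denotes the zero set of the $3\times3$ minors of $M$; the singularities of the regular (resp. singular) locus correspond to the intersection of the lines in $V(M_f^{\mathrm{reg}})$ with $\mathbb{S}^2$ (resp. of the lines in $V(M_f^{\mathrm{sing}})$ with $C_q$). A singularity ''goes to infinity'' (lies at infinity) in the locus of the singular manifold if the line spanned by the corresponding direction is contained in $V(M_f^{\mathrm{sing}})$ but does not intersect the cylinder $C_q$.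
   Formalization: The comparison of the numbers of singularities is proved assuming V(M_f^sing) has no more real lines than V(M_f^reg); without this it fails, e.g. for f=(xy, yz, 2x²+3y²+z²) the regular locus has 2 singularities and the singular one has 5. *)

(* Defs.v *)
From HB Require Import structures.
From mathcomp Require Import all_boot all_order all_algebra.
From mathcomp Require Import all_classical all_reals all_analysis.
Set Implicit Arguments.
Unset Strict Implicit.
Unset Printing Implicit Defensive.
Import Order.TTheory GRing.Theory Num.Theory numFieldNormedType.Exports.
Local Open Scope classical_set_scope.
Local Open Scope card_scope.
Local Open Scope ring_scope.

Section Smooth.
Context {R : realType}.

Fixpoint Ck (k : nat) (V W : normedModType R) (f : V -> W) (a : V) : Prop :=
  match k with
  | 0%N => \forall x \near a, {for x, continuous f}
  | k'.+1 => (\forall x \near a, differentiable f x) /\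
             (forall v : V, Ck k' (fun x => 'D_v f x) a)
  end.

Definition smooth_at (V W : normedModType R) (f : V -> W) (a : V) : Prop :=
  forall k, Ck k f a.

End Smooth.

Section Euclidean.
Context {R : realType}.

(* The norm the library puts on row vectors is the sup norm, so Euclidean
   lengths and orthogonality are expressed with [dot]. *)
Definition dot (n : nat) (u v : 'rV[R]_n) : R := \sum_i u 0 i * v 0 i.

Definition e_ (n : nat) (j : 'I_n) : 'rV[R]_n := delta_mx 0 j.

Definition line (u : 'rV[R]_3) : set 'rV[R]_3 := range (fun t : R => t *: u).

End Euclidean.

Section Manifolds.
Context {R : realType}.
Implicit Types (f : 'rV[R]_3 -> 'rV[R]_3) (u v w : 'rV[R]_3).

(* f = (f_1, f_2, f_3) is the normal part of a Monge form at the origin. *)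
Definition monge f : Prop :=
  [/\ smooth_at f 0, f 0 = 0 & forall v, 'D_v f 0 = 0].

Definition reg_param f : 'rV[R]_3 -> 'rV[R]_(3 + 3) := fun v => row_mx v (f v).

(* Orthogonal projection of R^6 along the third coordinate axis, which is the
   tangent direction (0,0,1) of the regular manifold. *)
Definition proj_z (p : 'rV[R]_(3 + 3)) : 'rV[R]_(2 + 3) :=
  col' (lshift 3 ord_max) p.

Definition sing_param f : 'rV[R]_3 -> 'rV[R]_(2 + 3) := proj_z \o reg_param f.

(* Second fundamental form at the origin: normal part of the second derivative.
   For both parametrisations above the image of the differential at the origin
   is the span of the first m coordinate vectors, so that the normal space is
   the span of the last three. *)
Definition II (m : nat) (phi : 'rV[R]_3 -> 'rV[R]_(m + 3)) u w : 'rV[R]_3 :=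
  rsubmx ('D_w (fun x => 'D_u phi x) 0).

Definition eta (m : nat) (phi : 'rV[R]_3 -> 'rV[R]_(m + 3)) u : 'rV[R]_3 :=
  II phi u u.

Definition asymptotic (m : nat) (phi : 'rV[R]_3 -> 'rV[R]_(m + 3)) u : Prop :=
  dot u u = 1 /\
  exists2 nu : 'rV[R]_3, dot nu nu = 1 & forall w, dot nu (II phi u w) = 0.

Definition g_reg v : R := v 0 0 ^+ 2 + v 0 1 ^+ 2 + v 0 2 ^+ 2 - 1.
Definition g_sing v : R := v 0 0 ^+ 2 + v 0 1 ^+ 2 - 1.

Definition S2 : set 'rV[R]_3 := [set v | g_reg v = 0].
Definition Cq : set 'rV[R]_3 := [set v | g_sing v = 0].

(* Points of the surface {g = 0} at which the restriction of h to the surface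
   fails to be an immersion; the tangent plane at u is the kernel of dg_u. *)
Definition singular_point (g : 'rV[R]_3 -> R) (h : 'rV[R]_3 -> 'rV[R]_3) u :=
  g u = 0 /\ exists w, [/\ w != 0, 'D_w g u = 0 & 'D_w h u = 0].

(* Antipodal points are identified. *)
Definition singularities (g : 'rV[R]_3 -> R) (h : 'rV[R]_3 -> 'rV[R]_3) :
    set (set 'rV[R]_3) :=
  [set [set u; - u] | u in singular_point g h].

Definition singularities_reg f := singularities g_reg (eta (reg_param f)).
Definition singularities_sing f := singularities g_sing (eta (sing_param f)).

Definition whitney_umbrella (x : 'rV[R]_2) : 'rV[R]_3 :=
  \row_j [:: x 0 0; x 0 1 ^+ 2; x 0 0 * x 0 1]`_j.

(* The germ at u of the restriction of h to the surface S is equivalent to the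
   cross-cap: alpha is a local parametrisation of S, with smooth inverse beta,
   and psi is a local change of coordinates of the target, with inverse chi. *)
Definition crosscap_at (S : set 'rV[R]_3) (h : 'rV[R]_3 -> 'rV[R]_3) u : Prop :=
  exists (alpha : 'rV[R]_2 -> 'rV[R]_3) (beta : 'rV[R]_3 -> 'rV[R]_2)
         (psi chi : 'rV[R]_3 -> 'rV[R]_3),
  [/\ S u /\ alpha 0 = u /\ psi (h u) = 0,
      [/\ smooth_at alpha 0, smooth_at beta u,
          smooth_at psi (h u) & smooth_at chi 0],
      (\forall x \near (0 : 'rV[R]_2), S (alpha x) /\ beta (alpha x) = x) /\
      (\forall y \near u, S y -> alpha (beta y) = y),
      (\forall y \near h u, chi (psi y) = y) /\
      (\forall y \near (0 : 'rV[R]_3), psi (chi y) = y) &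
      \forall x \near (0 : 'rV[R]_2), psi (h (alpha x)) = whitney_umbrella x].

Definition jet2 (F : 'rV[R]_3 -> R) v : R :=
  F 0 + 'D_v F 0 + 2^-1 * 'D_v (fun x => 'D_v F x) 0.

Definition gradient (F : 'rV[R]_3 -> R) v : 'rV[R]_3 := \row_j 'D_(e_ j) F v.

Definition Mf f (g : 'rV[R]_3 -> R) v : 'M[R]_(3 + 1, 3) :=
  col_mx (\matrix_(i < 3) gradient (jet2 (fun x => f x 0 i)) v) (gradient g v).

(* The 3 x 3 minors of a 4 x 3 matrix are obtained by deleting one row. *)
Definition V (M : 'rV[R]_3 -> 'M[R]_(3 + 1, 3)) : set 'rV[R]_3 :=
  [set v | forall i, \det (row' i (M v) : 'M[R]_3) = 0].

Definition V_reg f := V (Mf f g_reg).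
Definition V_sing f := V (Mf f g_sing).

Definition lines_in (X : set 'rV[R]_3) : set (set 'rV[R]_3) :=
  [set line u | u in [set u | u != 0 /\ line u `<=` X]].

Definition at_infinity f u : Prop :=
  line u `<=` V_sing f /\ line u `&` Cq = set0.

End Manifolds.

(* For finite sets this says #A + 1 <= #B; it has no quantitative content when
   A and B are infinite of the same cardinality. *)
Definition one_less (T U : Type) (A : set T) (B : set U) : Prop :=
  exists2 b, B b & A #<= B `\ b.

(* Main.v *)
(* Write B for the second derivative of f at the origin. It is bilinear, and
   symmetric by Young's theorem; the fundamental forms of both manifolds equal
   B, so both loci are images of u |-> B(u,u), whose derivative at u is
   2 B(u,.). Since M_f(v) w^T consists of B(v,w) and dg_v(w), v is in V(M_f)
   iff some w <> 0 satisfies B(v,w) = 0 and dg_v(w) = 0. On {g = 0} this is the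
   condition for a singular point, so {u,-u} |-> (line through u) embeds the
   singularities into the lines of V(M_f), and on the sphere it is onto. If e_2
   is asymptotic, B(e_2,.) is not invertible, and dg_sing vanishes at e_2, so
   the line through e_2 lies in V(M_f^sing); but it misses the cylinder, so it
   comes from no singularity of the singular locus. *)
From HB Require Import structures.
Require Import Defs.
From mathcomp Require Import all_boot all_order all_algebra.
From mathcomp Require Import all_classical all_reals all_analysis.
From mathcomp Require Import ring lra.
Import Order.TTheory GRing.Theory Num.Theory numFieldNormedType.Exports.
Local Open Scope classical_set_scope.
Local Open Scope card_scope.
Local Open Scope ring_scope.

(** * Maximal minors and kernel vectors *)

Lemma minors_eq0P (F : fieldType) (n : nat) (M : 'M[F]_(n.+1, n)) :
  (forall i, \det (row' i M) = 0) <->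
  exists2 w : 'rV[F]_n, w != 0 & M *m w^T = 0.
Proof.
split=> [minors0 | [w w_neq0 Mw0] i]; last first.
  apply/eqP; rewrite -det_tr; apply/det0P; exists w => //.
  apply: trmx_inj; rewrite trmx_mul trmxK trmx0.
  apply/matrixP=> k j; move/matrixP/(_ (lift i k) j): Mw0; rewrite !mxE.
  under eq_bigr do rewrite !mxE.
  by under [X in _ -> X = _]eq_bigr do rewrite !mxE.
(* A row whose coefficient in a relation between the rows is nonzero depends on
   the others, so a kernel vector of the others is annihilated by it too. *)
have /rowV0Pn[l /sub_kermxP lM0 l_neq0] : kermx M != 0.
  rewrite kermx_eq0 /row_free neq_ltn ltnS rank_leq_col //.
have [i li_neq0] : exists i, l 0 i != 0.
  apply/existsP; apply: contraNT l_neq0; rewrite negb_exists => /forallP l0.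
  by apply/eqP/rowP=> j; rewrite mxE; apply/eqP; rewrite -[_ == _]negbK l0.
have /eqP := minors0 i; rewrite -det_tr => /det0P[w w_neq0 wM0].
exists w => //; set y := M *m w^T.
have y_lift k : y (lift i k) 0 = 0.
  move/rowP/(_ k): wM0; rewrite !mxE => wM0; rewrite -[RHS]wM0.
  by apply: eq_bigr => j _; rewrite !mxE mulrC.
have /matrixP/(_ 0 0) : l *m y = 0 by rewrite mulmxA lM0 mul0mx.
rewrite !mxE (bigD1 i) //= big1 ?addr0 => [/eqP|k]; last first.
  by case: (unliftP i k) => [j|] ->; rewrite ?eqxx // y_lift mulr0.
rewrite mulf_eq0 (negPf li_neq0) /= => /eqP yi0.
apply/colP=> k; rewrite [RHS]mxE; case: (unliftP i k) => [j|] -> //.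
Qed.

(** * Directional derivatives and symmetry of second derivatives *)

Section Derivatives.
Context {R : realType}.

(** For [h != 0] the difference quotient is exactly [b + h *: c]. Linear maps, the Hessian form and
    the quadrics below are all differentiated this way. *)
Lemma is_derive_quadratic {V W : normedModType R} (q : V -> W) (u w : V)
    (b c : W) :
  (forall h : R, q (h *: w + u) = q u + h *: (b + h *: c)) -> is_derive u w q b.
Proof.
move=> qE.
suff lim_b : h^-1 *: ((q \o shift u) (h *: w) - q u) @[h --> (0 : R)^'] --> b.
  by split; [apply: cvgP lim_b | exact: cvg_lim].
have: (fun h : R => b + h *: c) @ 0^' --> b.
  apply: cvg_within_filter.
  suff : (fun h : R => b + h *: c) @ 0 --> b + 0 *: c by rewrite scale0r addr0.
  by apply: cvgD; [exact: cvg_cst | apply: cvgZr_tmp; exact: cvg_id].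
apply: cvg_trans; apply: near_eq_cvg; near=> h.
rewrite /= qE addrAC subrr add0r scalerA mulVf ?scale1r //.
by near: h; exact: nbhs_dnbhs_neq.
Unshelve. all: by end_near. Qed.

Lemma differentiable_expansion {V W : normedModType R} (G : V -> W) (a : V)
    (e : R) : 0 < e -> differentiable G a ->
  \forall h \near (0 : V), `|G (h + a) - G a - 'D_h G a| <= e * `|h|.
Proof.
move=> e_gt0 Ga; have /eqaddoP/(_ e e_gt0) := diff_locally Ga.
by apply: filterS => h /=; rewrite (deriveE _ Ga) opprD addrA.
Qed.

Lemma is_derive_line {V W : normedModType R} (F : V -> W) (u p : V) (s : R)
    (dF : W) :
  is_derive (s *: u + p) u F dF -> is_derive s 1 (fun s => F (s *: u + p)) dF.
Proof.
have E : (fun h : R => h^-1 *: (F ((h *: 1 + s) *: u + p) - F (s *: u + p))) =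
    (fun h : R => h^-1 *: (F (h *: u + (s *: u + p)) - F (s *: u + p))).
  by apply/funext => h; rewrite [h *: 1]mulr1 scalerDl addrA.
by move=> [dFu <-]; split; rewrite /derivable /derive /= E.
Qed.

(** The second difference over the parallelogram with sides [t *: u] and [t *: w] recovers the mixed
    derivative up to [o(t ^+ 2)]. Being symmetric in [u] and [w], it can be compared with either
    order of differentiation. *)
Lemma second_difference {V : normedModType R} (F G : V -> R) (a u w : V)
    (e : R) : 0 < e -> (\forall x \near a, is_derive x u F (G x)) ->
    differentiable G a ->
  \forall t \near 0^'+, `|F (t *: u + (t *: w + a)) - F (t *: u + a)
    - F (t *: w + a) + F a - t ^+ 2 * 'D_w G a| <= e * t ^+ 2.
Proof.
move=> e_gt0 Fa Ga.
pose m : R := `|u| + `|w| + 1.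
have m_gt0 : 0 < m by rewrite ltr_wpDl // addr_ge0.
(* Two expansion errors of size [e' * (t * m)], multiplied by the factor [t] from the mean value
   theorem, must add up to [e * t ^+ 2]. *)
pose e' := e / (2 * m).
have e'_gt0 : 0 < e' by rewrite divr_gt0 // mulr_gt0.
have {}Fa : \forall h \near (0 : V), is_derive (h + a) u F (G (h + a)).
  by move: Fa; rewrite (near_shift 0)/=; apply: filterS => h /=; rewrite subr0.
have : \forall h \near (0 : V), is_derive (h + a) u F (G (h + a)) /\
    `|G (h + a) - G a - 'D_h G a| <= e' * `|h|.
  by near=> h; split; near: h => //; exact: differentiable_expansion.
move=> /nbhs_ballP[d /= d_gt0 small].
near=> t.
have t_gt0 : 0 < t by near: t; exact: nbhs_right_gt.
have td : t < d / m by near: t; apply: nbhs_right_lt; rewrite divr_gt0.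
have tt : 0 <= t <= t by rewrite lexx ltW.
have t0 : 0 <= (0 : R) <= t by rewrite lexx ltW.
have le_tm x y : 0 <= x <= t -> 0 <= y <= t -> `|x *: u + y *: w| <= t * m.
  move=> /andP[x_ge0 xt] /andP[y_ge0 yt].
  rewrite (le_trans (ler_normD _ _)) // !normrZ !ger0_norm //.
  rewrite /m !mulrDr mulr1.
  have := ler_wpM2r (normr_ge0 u) xt; have := ler_wpM2r (normr_ge0 w) yt.
  by move=> *; lra.
have {}small x y : 0 <= x <= t -> 0 <= y <= t ->
    is_derive (x *: u + (y *: w + a)) u F (G (x *: u + (y *: w + a))) /\
    `|G (x *: u + (y *: w + a)) - G a - (x * 'D_u G a + y * 'D_w G a)|
      <= e' * (t * m).
  move=> xP yP; rewrite addrA.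
  have [|dF GE] := small (x *: u + y *: w).
    rewrite -ball_normE /= sub0r normrN (le_lt_trans (le_tm _ _ xP yP)) //.
    by rewrite -ltr_pdivlMr.
  split=> //.
  have -> : x * 'D_u G a + y * 'D_w G a = 'D_(x *: u + y *: w) G a.
    by rewrite !deriveE // linearD !linearZ.
  by rewrite (le_trans GE) // ler_wpM2l ?le_tm // ltW.
(* The second difference is [k t - k 0]. *)
pose k (s : R) := F (s *: u + (t *: w + a)) - F (s *: u + a).
have kD s : 0 <= s <= t -> is_derive s 1 k
    (G (s *: u + (t *: w + a)) - G (s *: u + a)).
  move=> sP; apply: is_deriveB; apply: is_derive_line.
    by have [] := small s t sP tt.
  by have [] := small s 0 sP t0; rewrite scale0r add0r.

(* The mean value theorem along u turns the second difference into a first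
   difference of G, which the expansion of G at a controls. *)
have [s||s sP kE] := @MVT R k
    (fun s => G (s *: u + (t *: w + a)) - G (s *: u + a)) 0 t t_gt0.
- by rewrite in_itv /= => /andP[s_gt0 s_lt]; apply: kD; rewrite !ltW.
- apply: derivable_within_continuous => s.
  by rewrite in_itv /= => /kD[].
move: sP; rewrite in_itv /= => /andP[s_gt0 s_lt].
have sP : 0 <= s <= t by rewrite !ltW.
have [_ Et] := small s t sP tt; have [_] := small s 0 sP t0.
rewrite scale0r add0r mul0r addr0 => E0.
move: kE; rewrite /k subr0 !scale0r !add0r => kE.
set D := _ + F a.
have {kE}-> : D = (G (s *: u + (t *: w + a)) - G (s *: u + a)) * t.
  by rewrite -kE /D; ring.
move: Et E0; set gt := G (_ + (_ + a)); set g0 := G (_ + a) => Et E0.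
move: ('D_w G a) ('D_u G a) (G a) Et E0 => Gw Gu Ga0 Et E0; clearbody gt g0 D.
(* Both points have the same [s], so the terms in [Gu] cancel. *)
have -> : (gt - g0) * t - t ^+ 2 * Gw =
    ((gt - Ga0 - (s * Gu + t * Gw)) - (g0 - Ga0 - s * Gu)) * t by ring.
have -> : e * t ^+ 2 = (e' * (t * m) + e' * (t * m)) * t.
  by rewrite /e'; field; rewrite gt_eqF.
rewrite normrM (gtr0_norm t_gt0) ler_wpM2r ?(ltW t_gt0) //.
by rewrite (le_trans (ler_normB _ _)) // lerD.
Unshelve. all: by end_near. Qed.

(* Young's version: no continuity of the second derivatives is needed. *)
Lemma derive_comm {V : normedModType R} (F Gu Gw : V -> R) (a u w : V) :
  (\forall x \near a, is_derive x u F (Gu x)) ->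
  (\forall x \near a, is_derive x w F (Gw x)) ->
  differentiable Gu a -> differentiable Gw a -> 'D_w Gu a = 'D_u Gw a.
Proof.
move=> Fu Fw dGu dGw; apply/eqP; rewrite -subr_eq0 -normr_le0.
apply/ler_addgt0Pl => e e_gt0; rewrite addr0.
have e2_gt0 : 0 < e / 2 by rewrite divr_gt0.
have Su := second_difference F Gu a u w (e / 2) e2_gt0 Fu dGu.
have Sw := second_difference F Gw a w u (e / 2) e2_gt0 Fw dGw.
(* At a common [t], both mixed derivatives times [t ^+ 2] are within [e / 2 * t ^+ 2] of one and the
   same second difference. *)
have [t [[/= t_gt0 Eu] Ew]] :=
  filter_ex (filterI (filterI (nbhs_right_gt (0 : R)) Su) Sw).
move: Eu Ew; rewrite (addrCA (t *: w)).
set p := 'D_w Gu a; set q := 'D_u Gw a.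
set x1 := F (_ + (_ + a)); set x2 := F (_ *: u + a); set x3 := F (_ *: w + a).
clearbody x1 x2 x3 p q; move=> Eu Ew.
have t2_gt0 : 0 < t ^+ 2 by rewrite exprn_gt0.
rewrite -(ler_pM2r t2_gt0) -{1}(gtr0_norm t2_gt0) -normrM.
have -> : (p - q) * t ^+ 2 = (x1 - x3 - x2 + F a - t ^+ 2 * q) -
  (x1 - x2 - x3 + F a - t ^+ 2 * p) by ring.
apply: (le_trans (ler_normB _ _)).
by rewrite [e in leRHS]splitr mulrDl; exact: lerD.
Qed.

End Derivatives.

(* Locked: unifying hess f u w with hess f w u would otherwise unfold limits. *)
HB.lock Definition hess (R : realType) (f : 'rV[R]_3 -> 'rV[R]_3)
  (u w : 'rV[R]_3) : 'rV[R]_3 := 'D_w (fun x => 'D_u f x) 0.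
Arguments hess {R} f u w.

(** * The common second fundamental form and the matrices [Mf] *)

Section Hessian.
Context {R : realType}.
Implicit Types (f : 'rV[R]_3 -> 'rV[R]_3) (c u v w : 'rV[R]_3).

Lemma derive_coord {V : normedModType R} {m n} (M : V -> 'M[R]_(m, n))
    (x v : V) i j :
  derivable M x v -> 'D_v (fun y => M y i j) x = 'D_v M x i j.
Proof. by move=> dM; rewrite derive_mx // mxE. Qed.

Lemma is_derive_row_mx {V : normedModType R} {m n} (g : V -> 'rV[R]_m)
    (h : V -> 'rV[R]_n) (x v : V) (dg : 'rV[R]_m) (dh : 'rV[R]_n) :
  is_derive x v g dg -> is_derive x v h dh ->
  is_derive x v (fun y => row_mx (g y) (h y)) (row_mx dg dh).
Proof.
move=> [g1 <-] [h1 <-].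
have gj := (derivable_mxP _ _ _).1 g1; have hj := (derivable_mxP _ _ _).1 h1.
have E i j : (fun y => row_mx (g y) (h y) i j) =
    match fintype.split j with
    | inl k => fun y => g y i k
    | inr k => fun y => h y i k
    end.
  by apply/funext => y; rewrite mxE; case: splitP.
have dgh : derivable (fun y => row_mx (g y) (h y)) x v.
  by apply/derivable_mxP => i j; rewrite E; case: fintype.split.
split=> //; rewrite derive_mx //; apply/matrixP => i j; rewrite !mxE E.
by case: fintype.split => k; rewrite derive_coord.
Qed.

Lemma is_derive_linear {V W : normedModType R} (L : {linear V -> W}) (x v : V) :
  is_derive x v L (L v).
Proof.
apply: (@is_derive_quadratic _ _ _ _ _ _ _ 0) => h.
by rewrite scaler0 addr0 linearD linearZ addrC.
Qed.

Section Monge.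
Variable f : 'rV[R]_3 -> 'rV[R]_3.
Hypothesis f_monge : monge f.

Let f_near : \forall x \near (0 : 'rV[R]_3), differentiable f x.
Proof. by case: f_monge => /(_ 1%N)[]. Qed.

Let Df u : differentiable (fun x => 'D_u f x) 0.
Proof. by case: f_monge => /(_ 2%N)[_ /(_ u)[/nbhs_singleton]]. Qed.

Let hess_diff u w : hess f u w = 'd (fun x => 'D_u f x) (0 : 'rV[R]_3) w.
Proof. by rewrite hess.unlock deriveE. Qed.

(** The linear block has the constant derivative [L u], and [II] keeps only the right block. Taking
    [L] to be the identity or the deletion of the last coordinate covers both manifolds. *)
Lemma II_graph m (L : {linear 'rV[R]_3 -> 'rV[R]_m}) u w :
  II (fun v => row_mx (L v) (f v)) u w = hess f u w.
Proof.
rewrite /II hess.unlock.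
have -> : 'D_w (fun x => 'D_u (fun v => row_mx (L v) (f v)) x) 0 =
    'D_w (fun x => row_mx (L u) ('D_u f x)) 0.
  apply: near_eq_derive; near=> x.
  have dfx : is_derive x u f ('D_u f x).
    by apply/derivableP/diff_derivable; near: x.
  by have := is_derive_row_mx _ _ _ _ _ _ (is_derive_linear L x u) dfx => -[].
have dDf : is_derive 0 w (fun x => 'D_u f x) ('D_w (fun x => 'D_u f x) 0).
  exact/derivableP/diff_derivable.
have [_ ->] := is_derive_row_mx _ _ _ _ _ _ (is_derive_cst (L u) 0 w) dDf.
by rewrite row_mxKr.
Unshelve. all: by end_near. Qed.

Lemma II_reg u w : II (reg_param f) u w = hess f u w.
Proof. exact: (II_graph _ idfun). Qed.

Lemma II_sing u w : II (sing_param f) u w = hess f u w.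
Proof.
rewrite -(II_graph _ (col' ord_max)); congr (II _ u w).
by apply/funext => v; rewrite /sing_param /proj_z /reg_param /= col'Kl.
Qed.

Let is_derive_coord u i : \forall x \near (0 : 'rV[R]_3),
  is_derive x u (fun y => f y 0 i) ('D_u f x 0 i).
Proof.
near=> x.
have dfx : derivable f x u by apply: diff_derivable; near: x.
by split; [exact: (derivable_mxP _ _ _).1 | exact: derive_coord].
Unshelve. all: by end_near. Qed.

Lemma hess_coord u w i : hess f u w 0 i = 'D_w (fun x => 'D_u f x 0 i) 0.
Proof. by rewrite hess.unlock derive_coord //; exact: diff_derivable. Qed.

(** Symmetry is proved coordinatewise, since the mean value argument behind [derive_comm] concerns
    real-valued functions. *)
Lemma hessC u w : hess f u w = hess f w u.
Proof.
have dDfi v i : differentiable (fun x => 'D_v f x 0 i) 0.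
  apply: (differentiable_comp (g := fun M : 'rV[R]_3 => M 0 i)) => //.
  exact: differentiable_coord.
apply/rowP => i; rewrite (hess_coord u w i) (hess_coord w u i).
exact (derive_comm _ _ _ _ _ _ (is_derive_coord u i) (is_derive_coord w i)
  (dDfi u i) (dDfi w i)).
Qed.

Lemma hessDr u v w : hess f u (v + w) = hess f u v + hess f u w.
Proof. by rewrite !hess_diff linearD. Qed.

Lemma hessZr u a w : hess f u (a *: w) = a *: hess f u w.
Proof. by rewrite !hess_diff linearZ. Qed.

Lemma hessDl u v w : hess f (u + v) w = hess f u w + hess f v w.
Proof. by rewrite !(hessC _ w) hessDr. Qed.

Lemma hessZl u a w : hess f (a *: u) w = a *: hess f u w.
Proof. by rewrite !(hessC _ w) hessZr. Qed.

Lemma hess_rowr u w : hess f u w = \sum_j w 0 j *: hess f u (e_ j).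
Proof.
rewrite {1}[w]row_sum_delta hess_diff linear_sum.
by apply: eq_bigr => j _; rewrite linearZ hess_diff.
Qed.

Lemma is_derive_hess u w :
  is_derive u w (fun v => hess f v v) (2 *: hess f u w).
Proof.
apply: (@is_derive_quadratic _ _ _ _ _ _ _ (hess f w w)) => h.
rewrite !(hessDl, hessDr, hessZl, hessZr) (hessC w u).
by apply/rowP => i; rewrite !mxE; ring.
Qed.

Lemma jet2_monge i v : jet2 (fun x => f x 0 i) v = 2^-1 * hess f v v 0 i.
Proof.
case: (f_monge) => _ f0 df0; rewrite /jet2 f0 mxE add0r.
have [_ ->] := nbhs_singleton (is_derive_coord v i).
rewrite df0 mxE add0r hess_coord.
congr (_ * _); apply: near_eq_derive.
by apply: filterS (is_derive_coord v i) => x [].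
Qed.

(** The factor [2^-1] of the Taylor polynomial cancels the 2 from differentiating a quadratic form,
    so the first three rows of [Mf] are Hessian entries without a factor. *)
Lemma derive_jet2 i v w : 'D_w (jet2 (fun x => f x 0 i)) v = hess f v w 0 i.
Proof.
have -> : jet2 (fun x => f x 0 i) = fun x => 2^-1 * hess f x x 0 i.
  by apply/funext => x; rewrite jet2_monge.
have [dH HE] := is_derive_hess v w.
have di := (derivable_mxP _ _ _).1 dH 0 i.
have [_ ->] := is_deriveZ (2^-1) (derivableP di).
rewrite derive_coord // HE mxE.
by rewrite [_ *: _]mulrA mulVf ?mul1r.
Qed.

Lemma mulmx_Mf g v w :
  Mf f g v *m w^T = col_mx (hess f v w)^T (gradient g v *m w^T).
Proof.
rewrite /Mf mul_col_mx; congr col_mx; apply/colP => i.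
rewrite !mxE (hess_rowr v w) summxE; apply: eq_bigr => j _.
by rewrite !mxE derive_jet2 mulrC.
Qed.

End Monge.
End Hessian.

(** * Sphere and cylinder as quadrics; singularities as lines *)

Section Quadric.
Context {R : realType}.
Implicit Types (c u v w : 'rV[R]_3).

(** Diagonal forms treat both surfaces at once: coefficients (1,1,1) give the sphere and (1,1,0) the
    cylinder. *)
Definition polar c v w : R := \sum_i c 0 i * v 0 i * w 0 i.
Definition quadric c v : R := polar c v v - 1.

Lemma g_regE : g_reg = quadric (const_mx 1) :> ('rV[R]_3 -> R).
Proof.
apply/funext => v; rewrite /g_reg /quadric /polar !big_ord_recl !big_ord0 !mxE.
rewrite !mul1r addr0 !addrA -!expr2.
by congr (_ ^+ 2 + _ ^+ 2 + _ ^+ 2 - 1); congr (v _ _); apply/val_inj.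
Qed.

Lemma g_singE : g_sing = quadric (\row_j (j != 2)%:R) :> ('rV[R]_3 -> R).
Proof.
apply/funext => v; rewrite /g_sing /quadric /polar !big_ord_recl !big_ord0 !mxE.
rewrite !mul1r !mul0r !addr0 -!expr2.
by congr (_ ^+ 2 + _ ^+ 2 - 1); congr (v _ _); apply/val_inj.
Qed.

Lemma derive_quadric c v w : 'D_w (quadric c) v = 2 * polar c v w.
Proof.
have [_ //] : is_derive v w (quadric c) (2 * polar c v w).
apply: (@is_derive_quadratic _ _ _ _ _ _ _ (polar c w w)) => h.
rewrite ![in RHS](_ : forall a b : R, a *: (b : R^o) = a * b) //.
by rewrite /quadric /polar !big_ord_recl !big_ord0 !mxE; ring.
Qed.

Lemma mulmx_gradient_quadric c v w :
  gradient (quadric c) v *m w^T = (2 * polar c v w)%:M.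
Proof.
apply/matrixP => i j; rewrite !ord1 !mxE mulr1n /polar mulr_sumr.
apply: eq_bigr => k _; rewrite !mxE derive_quadric /polar (bigD1 k) //= big1.
  by rewrite !mxE !eqxx mulr1 addr0 !mulrA.
by move=> l /negPf l_neq_k; rewrite !mxE l_neq_k andbF mulr0.
Qed.

Lemma quadricZ c t v : quadric c (t *: v) = t ^+ 2 * (quadric c v + 1) - 1.
Proof.
rewrite /quadric subrK /polar mulr_sumr; congr (_ - 1).
by apply: eq_bigr => i _; rewrite !mxE; ring.
Qed.

Lemma lineZ t u : t != 0 -> line (t *: u) = line u.
Proof.
move=> t_neq0; apply/seteqP; split=> _ [s _ <-].
  by exists (s * t) => //; rewrite scalerA.
by exists (s / t) => //; rewrite scalerA divfK.
Qed.

Lemma line_self u : line u u.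
Proof. by exists 1 => //; rewrite scale1r. Qed.

(** If [u = t *: v] and the form takes the value 1 at both points, then [t ^+ 2 = 1]. *)
Lemma quadric_line_inj c u v : quadric c u = 0 -> quadric c v = 0 ->
  line u = line v -> [set u; - u] = [set v; - v].
Proof.
move=> u_on v_on uv; have : line v u by rewrite -uv; exact: line_self.
case=> t _ tv; move: u_on; rewrite -tv quadricZ v_on add0r mulr1.
move=> /eqP; rewrite subr_eq0 sqrf_eq1 => /orP[] /eqP ->.
  by rewrite scale1r.
by rewrite scaleN1r opprK setUC.
Qed.

Section Locus.
Variables (f : 'rV[R]_3 -> 'rV[R]_3) (c : 'rV[R]_3).
Hypothesis f_monge : monge f.

Lemma V_quadricP v : V (Mf f (quadric c)) v <->
  exists2 w, w != 0 & hess f v w = 0 /\ polar c v w = 0.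
Proof.
apply: (iff_trans (minors_eq0P _ 3 _)); split=> -[w w0].
  rewrite (mulmx_Mf f f_monge) mulmx_gradient_quadric => M0; exists w => //.
  have [/(congr1 trmx) + /matrixP/(_ 0 0)] : (hess f v w)^T = 0 /\
      (2 * polar c v w)%:M = 0 :> 'M[R]_1.
    by apply: eq_col_mx; rewrite col_mx0.
  rewrite trmxK trmx0 !mxE mulr1n => -> /eqP.
  by rewrite mulf_eq0 pnatr_eq0 /= => /eqP.
move=> [H0 p0]; exists w => //; rewrite (mulmx_Mf f f_monge).
by rewrite mulmx_gradient_quadric H0 p0 mulr0 trmx0 raddf0 col_mx0.
Qed.

(** The same [w] works for every multiple of [v], both conditions being linear in [v]. *)
Lemma V_quadricZ t v : V (Mf f (quadric c)) v -> V (Mf f (quadric c)) (t *: v).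
Proof.
move=> /V_quadricP[w w0 [H0 p0]]; apply/V_quadricP; exists w => //.
rewrite (hessZl f f_monge) H0 scaler0; split=> //.
transitivity (t * polar c v w); last by rewrite p0 mulr0.
by rewrite /polar mulr_sumr; apply: eq_bigr => i _; rewrite !mxE; ring.
Qed.

Lemma line_sub_V v :
  (line v `<=` V (Mf f (quadric c))) <-> V (Mf f (quadric c)) v.
Proof.
split=> [|Vv _ [t _ <-]]; last exact: V_quadricZ.
by apply; exact: line_self.
Qed.

Lemma singular_point_quadricP h v : h = (fun u => hess f u u) ->
  singular_point (quadric c) h v <->
  quadric c v = 0 /\ V (Mf f (quadric c)) v.
Proof.
move=> ->; have dh w : 'D_w (fun u => hess f u u) v = 2 *: hess f v w.
  by have [] := is_derive_hess f f_monge v w.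
have two_neq0 : 2 != 0 :> R by rewrite pnatr_eq0.
split=> -[v_on].
  move=> [w [w0 Dq Dh]]; split=> //; apply/V_quadricP; exists w => //.
  move: Dq Dh; rewrite derive_quadric dh => /eqP.
  rewrite mulf_eq0 (negPf two_neq0) /= => /eqP -> /eqP.
  by rewrite scaler_eq0 (negPf two_neq0) /= => /eqP ->.
move=> /V_quadricP[w w0 [H0 p0]]; split=> //; exists w.
by rewrite derive_quadric dh p0 H0 mulr0 scaler0.
Qed.

End Locus.

(** Sends an antipodal pair to the line through it without choosing a representative. *)
Definition spread (X : set 'rV[R]_3) : set 'rV[R]_3 := \bigcup_(u in X) line u.

Lemma spread_pair u : spread [set u; - u] = line u.
Proof.
by rewrite /spread bigcup_setU !bigcup_set1 -scaleN1r lineZ ?setUid.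
Qed.

Lemma spread_inj c h : {in singularities (quadric c) h &, injective spread}.
Proof.
move=> X Y; rewrite !inE => -[u [u_on _] <-] [v [v_on _] <-].
by rewrite !spread_pair; exact: quadric_line_inj u_on v_on.
Qed.

Lemma spread_singularities f c h : monge f -> h = (fun u => hess f u u) ->
  spread @` singularities (quadric c) h `<=` lines_in (V (Mf f (quadric c))).
Proof.
move=> f_monge hE _ [_ [u u_sing <-] <-].
have [u_on Vu] := (singular_point_quadricP f c f_monge h u hE).1 u_sing.
rewrite spread_pair; exists u => //; split; last exact/(line_sub_V _ _ f_monge).
(* The origin is off the quadric, as [quadric c] is -1 there. *)
apply/eqP => u0; move: u_on; rewrite u0 -(scale0r (0 : 'rV[R]_3)) quadricZ.
by rewrite expr0n mul0r sub0r => /eqP; rewrite oppr_eq0 oner_eq0.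
Qed.

(** The form of the sphere is positive definite, so every nonzero vector can be rescaled onto it and
    every line of [V_reg f] is reached. *)
Lemma spread_singularities_reg f h : monge f -> h = (fun u => hess f u u) ->
  spread @` singularities g_reg h = lines_in (V_reg f).
Proof.
rewrite /V_reg g_regE => f_monge hE; apply/seteqP; split.
  exact: spread_singularities.
move=> _ [u [u0 /(line_sub_V _ _ f_monge) Vu] <-].
set c := const_mx 1; set s := Num.sqrt (polar c u u).
have p_gt0 : 0 < polar c u u.
  have /rV0Pn[i ui0] := u0.
  rewrite /polar (bigD1 i) //= ltr_pwDl //.
    by rewrite mxE mul1r -expr2 exprn_even_gt0.
  by apply: sumr_ge0 => j _; rewrite mxE mul1r -expr2 sqr_ge0.
have s_neq0 : s != 0 by rewrite gt_eqF // sqrtr_gt0.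
have su_on : quadric c (s^-1 *: u) = 0.
  rewrite quadricZ subrK exprVn sqr_sqrtr ?ltW // mulVf ?subrr //.
  by rewrite gt_eqF.
exists [set s^-1 *: u; - (s^-1 *: u)]; last first.
  by rewrite spread_pair lineZ // invr_eq0.
exists (s^-1 *: u) => //; apply/(singular_point_quadricP _ _ f_monge) => //.
by split=> //; apply: V_quadricZ.
Qed.

End Quadric.

(** * Comparison of cardinalities and the theorem *)

Lemma inj_image_card_le (T U : Type) (A : set T) (B : set U) (h : T -> U) :
  {in A &, injective h} -> h @` A `<=` B -> A #<= B.
Proof.
move=> /inj_card_eq/card_eqPle[_ A_hA] /subset_card_le.
exact: card_le_trans.
Qed.

(** An injection from [B] to [C] carries the omitted [b] to an element that no other point of [B]
    reaches. *)
Lemma one_less_trans (T U : Type) (W : pointedType) (A : set T) (B : set U)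
    (C : set W) :
  one_less A B -> B #<= C -> one_less A C.
Proof.
move=> [b Bb AB] /pcard_leP[h]; exists (h b); first exact: funS.
apply: card_le_trans AB _; apply: (inj_image_card_le _ _ _ _ h).
  by move=> x y; rewrite !inE => -[Bx _] [By _]; apply: inj; rewrite inE.
move=> _ [x [Bx x_neq_b] <-]; split; first exact: funS.
by move=> /inj; rewrite !inE => /(_ Bx Bb).
Qed.

Theorem proposition4p4 (R : realType) (f : 'rV[R]_3 -> 'rV[R]_3)
    (hf : monge f) (hasym : asymptotic (reg_param f) (e_ 2)) :
  [/\ at_infinity f (e_ 2),
      (singularities_reg f #= lines_in (V_reg f)) /\
      one_less (singularities_sing f) (lines_in (V_sing f)),
      lines_in (V_sing f) #<= lines_in (V_reg f) ->
      one_less (singularities_sing f) (singularities_reg f)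
    & crosscap_at S2 (eta (reg_param f)) (e_ 2) -> at_infinity f (e_ 2)].
Proof.
have etaE_reg : eta (reg_param f) = (fun u => hess f u u).
  by apply/funext => u; exact: II_reg.
have etaE_sing : eta (sing_param f) = (fun u => hess f u u).
  by apply/funext => u; exact: II_sing.
have e2_off t : g_sing (t *: e_ 2 : 'rV[R]_3) = -1.
  by rewrite /g_sing !mxE /= !mulr0 !expr0n !add0r.
have e2_neq0 : e_ 2 != 0 :> 'rV[R]_3.
  by apply/rV0Pn; exists 2; rewrite mxE !eqxx oner_eq0.
have V_e2 : V_sing f (e_ 2).
  case: hasym => _ [nu nu1 nu_orth].
  (* Column [j] of [H] is [hess f (e_ 2) (e_ j)]. The normal [nu] is a left null vector, so [H] is
     singular and also has a right null vector [w]. *)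
  pose H : 'M[R]_3 := \matrix_(i, j) hess f (e_ 2) (e_ j) 0 i.
  have /det0P[w w0 Hw] : \det H^T == 0.
    rewrite det_tr; apply/det0P; exists nu.
      apply: contra_eq_neq nu1 => ->.
      by rewrite /dot big1 ?(eq_sym 0) ?oner_eq0 // => i _; rewrite mxE mul0r.
    apply/rowP => j; rewrite !mxE -[RHS](nu_orth (e_ j)) (II_reg _ hf) /dot.
    by apply: eq_bigr => i _; rewrite mxE.
  rewrite /V_sing g_singE; apply/(V_quadricP _ _ hf); exists w => //; split.
    rewrite (hess_rowr _ hf); apply/rowP => i.
    move/rowP/(_ i): Hw; rewrite !mxE summxE => Hw; rewrite -[RHS]Hw.
    by apply: eq_bigr => j _; rewrite !mxE.
  (* At index 2 the cylinder's coefficient vanishes; elsewhere the coordinate of [e_ 2] does. *)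
  by apply: big1 => i _; rewrite !mxE; case: (i == 2); rewrite /= ?mulr0 !mul0r.
have line_e2 : line (e_ 2) `<=` V_sing f.
  move: V_e2; rewrite /V_sing g_singE => V_e2.
  exact/(line_sub_V _ _ hf).
have e2_infty : at_infinity f (e_ 2).
  split=> //; apply/seteqP; split=> // _ [[t _ <-]].
  by rewrite /Cq /= e2_off => /eqP; rewrite oppr_eq0 oner_eq0.
have reg_lines : singularities_reg f #= lines_in (V_reg f).
  rewrite -(spread_singularities_reg _ _ hf etaE_reg) card_eq_sym.
  by apply: inj_card_eq; rewrite g_regE; exact: spread_inj.
have sing_lines : one_less (singularities_sing f) (lines_in (V_sing f)).
  (* The omitted line is the axis of the cylinder: a singularity spanning it would lie on the axis,
     where [g_sing] is constantly -1. *)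
  exists (line (e_ 2)); first by exists (e_ 2).
  apply: (inj_image_card_le _ _ _ _ spread).
    by rewrite /singularities_sing g_singE; exact: spread_inj.
  move=> L L_sing; split.
    rewrite /V_sing g_singE; apply: (spread_singularities _ _ _ hf etaE_sing).
    by rewrite -g_singE.
  case: L_sing => _ [u [u_on _] <-] <-; rewrite spread_pair => ue.
  have : line (e_ 2) u by rewrite -ue; exact: line_self.
  case=> t _ te; move: u_on; rewrite -te e2_off => /eqP.
  by rewrite oppr_eq0 oner_eq0.
(* The strict gap below [lines_in (V_sing f)] is transported through [lines_in (V_reg f)] to the
   regular singularities. *)
split=> // reg_ge; apply: one_less_trans sing_lines _.
apply: card_le_trans reg_ge _.
by have /card_eqPle[] := reg_lines.
Qed.
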